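(* The harm function admits the decomposition $$\mathrm{Harm}(y)=\mathbb{E}[\mathrm{Harm}]+\sum_{t=1}^T\Delta_t,$$ where the innovations are orthogonal: $\mathbb{E}[\Delta_s\Delta_t]=0$ for $s\ne t$.
   Context: Let $\mathcal V$ be a finite vocabulary, $T\ge1$, and let $P_\theta$ be a probability distribution on $y=(y_1,\dots,y_T)\in\mathcal V^T$ with $P_\theta(y)=\prod_{t=1}^TP_\theta(y_t\mid y_{<t})$, $y_{<t}=(y_1,\dots,y_{t-1})$, $y_{\le t}=(y_1,\dots,y_t)$. All expectations are under $y\sim P_\theta$. $\mathrm{Harm}:\mathcal V^T\to[0,1]$ is a fixed function. Conditional expected harm: $h_t(y_{\le t}):=\mathbb{E}[\mathrm{Harm}(y)\mid y_1,\dots,y_t]$ for $0\le t\le T$ (so $h_0=\mathbb{E}[\mathrm{Harm}]$). Harm innovation: $\Delta_t:=h_t(y_{\le t})-h_{t-1}(y_{<t})$. *)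

(* Defs.v *)
From mathcomp Require Import all_boot all_order all_algebra.

Set Implicit Arguments.
Unset Strict Implicit.
Unset Printing Implicit Defensive.

Import Order.TTheory GRing.Theory Num.Theory.
Local Open Scope ring_scope.

Section FiniteProbability.
Variables (R : realFieldType) (Omega : finType).
Implicit Types (P X : Omega -> R) (A B : {set Omega}).

Definition is_distr P : Prop :=
  (forall y, 0 <= P y) /\ \sum_y P y = 1.

Definition Pr P A : R := \sum_(y in A) P y.

Definition Ex P X : R := \sum_y P y * X y.

(* Pr(A | B) and E[X | B]; meaningful when Pr P B != 0 (division by zero
   gives 0). *)
Definition cPr P A B : R := Pr P (A :&: B) / Pr P B.

Definition cEx P X B : R := (\sum_(y in B) P y * X y) / Pr P B.

End FiniteProbability.

Section Sequences.
Variables (R : realFieldType) (V : finType) (T : nat).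
Implicit Types (P X : T.-tuple V -> R) (y : T.-tuple V) (w : seq V).

(* With y = (y_1, ..., y_T), take t y is the prefix (y_1, ..., y_t). *)
Definition prefix_event (t : nat) w : {set T.-tuple V} :=
  [set y : T.-tuple V | take t y == w].

(* P(y_t | y_1, ..., y_(t-1)), for 1 <= t <= T. *)
Definition token_prob P (t : nat) y : R :=
  cPr P (prefix_event t (take t y)) (prefix_event t.-1 (take t.-1 y)).

(* h t, evaluated at prefixes of length t, is a version of
   E[X | y_1, ..., y_t] for each 0 <= t <= T: it has the elementary value at
   every prefix of positive probability and is arbitrary at null prefixes. *)
Definition is_prefix_cEx P X (h : nat -> seq V -> R) : Prop :=
  forall t w, (t <= T)%N -> 0 < Pr P (prefix_event t w) ->
    h t w = cEx P X (prefix_event t w).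

(* For 1 <= t <= T. *)
Definition innovation (h : nat -> seq V -> R) (t : nat) y : R :=
  h t (take t y) - h t.-1 (take t.-1 y).

End Sequences.

(* Main.v *)
(** The sum of the innovations telescopes from [h 0] to [h T].  Orthogonality is
    the tower property: for [s < t] the innovation at [s] is a function of the
    first [t - 1] tokens, so its product with [h t] and its product with
    [h (t - 1)] both have the same expectation as its product with the harm. *)
Require Import Defs.
From mathcomp Require Import all_boot all_order all_algebra.

Import Order.TTheory GRing.Theory Num.Theory.
Local Open Scope ring_scope.

Lemma Pr_eq0 (R : realFieldType) (Omega : finType) (P : Omega -> R)
    (A : {set Omega}) (y : Omega) :
  (forall z, 0 <= P z) -> Pr P A = 0 -> y \in A -> P y = 0.
Proof.
move=> P_ge0 /eqP; rewrite psumr_eq0 => [/allP PA0 yA|z _]; last exact: P_ge0.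
by apply/eqP; have /implyP := PA0 y (mem_index_enum y); apply.
Qed.

Section Prefixes.
Context {R : realFieldType} {V : finType} {T : nat}.
Context {P X : T.-tuple V -> R} {h : nat -> seq V -> R}.
Hypotheses (P_distr : is_distr P) (h_cEx : is_prefix_cEx P X h).

(** This is the defining property of conditional expectation in integrated form. Multiplying through
    by the probability of the event makes it hold at null prefixes too. *)
Lemma sum_prefix_event (t : nat) (w : seq V) : (t <= T)%N ->
  \sum_(y in prefix_event T t w) P y * h t w =
  \sum_(y in prefix_event T t w) P y * X y.
Proof.
have [P_ge0 _] := P_distr => tT.
have Pr_ge0 : 0 <= Pr P (prefix_event T t w) by apply: sumr_ge0 => y _.
have [Pr0|Pr_neq0] := eqVneq (Pr P (prefix_event T t w)) 0.
  (* On a null event every [P y] vanishes, so the arbitrary value of [h t w] is harmless. *)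
  by apply: eq_bigr => y yw; rewrite (Pr_eq0 _ _ _ _ y P_ge0 Pr0 yw) !mul0r.
rewrite h_cEx ?lt0r ?Pr_neq0 // -mulr_suml -/(Pr P _) /cEx.
by rewrite mulrC divfK.
Qed.

Lemma Ex_prefix_cEx (t : nat) (g : seq V -> R) : (t <= T)%N ->
  Ex P (fun y => g (take t y) * h t (take t y)) =
  Ex P (fun y => g (take t y) * X y).
Proof.
move=> tT; rewrite /Ex.
(* Packing the prefix as a tuple gives it a finite type, over which the sum can be partitioned; [g]
   and [h t] are constant on each block. *)
pose p (y : T.-tuple V) := [tuple of take t y].
rewrite (partition_big p predT) //= [RHS](partition_big p predT) //=.
apply: eq_bigr => w _.
have pE y : (p y == w) = (y \in prefix_event T t w) by rewrite inE -val_eqE.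
transitivity (g w * \sum_(y in prefix_event T t w) P y * h t w).
  rewrite mulr_sumr; apply: eq_big => [y|y /eqP <-]; first exact: pE.
  by rewrite mulrCA.
rewrite sum_prefix_event // mulr_sumr.
apply: eq_big => [y|y]; first by rewrite pE.
by rewrite inE => /eqP ->; rewrite mulrCA.
Qed.

Lemma prefix_cEx0 : h 0%N [::] = Ex P X.
Proof.
have [_ P1] := P_distr.
have E y : (y \in prefix_event T 0 [::]) = true by rewrite inE take0 eqxx.
have Pr1 : Pr P (prefix_event T 0 [::]) = 1.
  by rewrite -P1; apply: eq_bigl => y; rewrite E.
rewrite h_cEx ?Pr1 ?ltr01 // /cEx Pr1 divr1.
by apply: eq_bigl => y; rewrite E.
Qed.

(** The full prefix determines [y], so its event is a singleton; [0 < P y] forces the value of [h T]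
    there. *)
Lemma prefix_cEx_full (y : T.-tuple V) : 0 < P y -> h T y = X y.
Proof.
move=> Py_gt0.
have E : prefix_event T T y = [set y].
  by apply/setP => z; rewrite !inE take_oversize ?size_tuple.
have PrE : Pr P (prefix_event T T y) = P y by rewrite E /Pr big_set1.
by rewrite h_cEx ?PrE // /cEx PrE E big_set1 mulrC mulKf // gt_eqF.
Qed.

Lemma sum_innovation (y : T.-tuple V) :
  \sum_(1 <= t < T.+1) innovation h t y = h T y - h 0%N [::].
Proof.
rewrite big_add1 /= (telescope_sumr (fun t => h t (take t y))) //.
by rewrite take0 take_oversize ?size_tuple.
Qed.

Lemma innovation_orthogonal (s t : nat) : (s < t <= T)%N ->
  Ex P (fun y => innovation h s y * innovation h t y) = 0.
Proof.
case/andP=> st tT.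
(* [g] recovers the innovation at [s] from any prefix of length [u >= s], the shape [Ex_prefix_cEx]
   needs. *)
pose g w : R := h s (take s w) - h s.-1 (take s.-1 w).
have gE u (y : T.-tuple V) : (s <= u)%N -> g (take u y) = innovation h s y.
  by move=> su; rewrite /g !take_takel // (leq_trans (leq_pred s)).
have ExE u : (s <= u <= T)%N ->
    Ex P (fun y => innovation h s y * h u (take u y)) =
    Ex P (fun y => innovation h s y * X y).
  case/andP=> su uT.
  transitivity (Ex P (fun y => g (take u y) * h u (take u y))).
    by apply: eq_bigr => y _; rewrite gE.
  by rewrite Ex_prefix_cEx //; apply: eq_bigr => y _; rewrite gE.
(* Strictness of [s < t] is what allows [ExE] at [u = t.-1] as well as at [u = t]. *)
have st1 : (s <= t.-1)%N by rewrite -ltnS (ltn_predK st).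
transitivity (Ex P (fun y => innovation h s y * h t (take t y)) -
              Ex P (fun y => innovation h s y * h t.-1 (take t.-1 y))).
  by rewrite /Ex -sumrB; apply: eq_bigr => y _; rewrite -!mulrBr.
by rewrite !ExE ?subrr ?st1 ?(ltnW st) // (leq_trans (leq_pred t)).
Qed.

End Prefixes.

Theorem proposition4 (R : realFieldType) (V : finType) (T : nat) (hT : (1 <= T)%N)
    (P : T.-tuple V -> R) (hP : is_distr P)
    (hfact : forall y : T.-tuple V, P y = \prod_(1 <= t < T.+1) token_prob P t y)
    (Harm : T.-tuple V -> R) (hHarm : forall y, 0 <= Harm y <= 1)
    (h : nat -> seq V -> R) (hh : is_prefix_cEx P Harm h) :
  (forall y : T.-tuple V, 0 < P y ->
     Harm y = Ex P Harm + \sum_(1 <= t < T.+1) innovation h t y) /\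
  (forall s t : nat, (1 <= s <= T)%N -> (1 <= t <= T)%N -> s <> t ->
     Ex P (fun y => innovation h s y * innovation h t y) = 0).
Proof.
split=> [y Py_gt0|s t /andP[_ sT] /andP[_ tT] /eqP].
  rewrite sum_innovation (prefix_cEx0 hP hh) (prefix_cEx_full hh) //.
  by rewrite addrC subrK.
rewrite neq_ltn => /orP[st|ts].
  by apply: (innovation_orthogonal hP hh); rewrite st.
(* The zero is replaced by the expectation with [s] and [t] exchanged, which leaves commutativity of
   the product. *)
rewrite -[RHS](innovation_orthogonal hP hh t s) ?ts //.
by apply: eq_bigr => y _; rewrite [_ * innovation h t y]mulrC.
Qed.
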